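(* Let $m\in\mathbb N$ and let $(W_i)_{i\in\mathbb N}$ be a countable family of prefix-independent $\Sigma_2^0$ objectives $W_i\subseteq C^\omega$, each having $\varepsilon$-memory $\le m$. Then $\bigcup_{i\in\mathbb N}W_i$ has $\varepsilon$-memory $\le m$.
   Context: An objective $W\subseteq C^\omega$ is $\Sigma_2^0$ if there is a language $L\subseteq C^*$ such that $W=\{w\in C^\omega: w\text{ has only finitely many prefixes in }L\}$. It is prefix-independent if $uw\in W\iff w\in W$ for all $u\in C^*$, $w\in C^\omega$. $\varepsilon$-memory: let $\varepsilon\notin C$; $W^\varepsilon$ is the set of $w\in(C\sqcup\{\varepsilon\})^\omega$ whose $\varepsilon$-free projection $w_C$ is infinite and in $W$, or finite with some $w'\in C^\omega$ such that $w_Cw'\in W$. A game is $(G,V_{\mathrm{Eve}},v_0,W^\varepsilon)$ with $G$ a $(C\sqcup\{\varepsilon\})$-graph (vertices, coloured directed edges $v\xrightarrow{c}v'$, no sinks). A strategy is $(S,\pi,s_0)$ with $S$ a graph, $\pi:S\to G$ an edge/colour-preserving map, $\pi(s_0)=v_0$, such that for $v\notin V_{\mathrm{Eve}}$, $v\xrightarrow{c}v'\in E(G)$, $s\in\pi^{-1}(v)$ there is $s'\in\pi^{-1}(v')$ with $s\xrightarrow{c}s'$; it is winning if every infinite path from $s_0$ has colour sequence in $W^\varepsilon$. An $\varepsilon$-strategy has $V(S)\subseteq V(G)\times M$, $\pi(v,m)=v$ and $\varepsilon$-edges preserving the $M$-component; its memory is $|M|$. $W$ has $\varepsilon$-memory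 $\le m$ if every such game admitting a winning strategy admits a winning $\varepsilon$-strategy of memory $\le m$. *)

(* Defs.v *)
From mathcomp Require Import all_boot.
Set Implicit Arguments. Unset Strict Implicit. Unset Printing Implicit Defensive.

Fixpoint prepend (C : Type) (u : seq C) (w : nat -> C) : nat -> C :=
  match u with
  | [::] => w
  | a :: u' => fun n => match n with 0 => a | k.+1 => prepend u' w k end
  end.

(* W is Sigma_2^0: there is L ⊆ C^* with W = {w | w has finitely many prefixes in L}.
   The prefixes of w are the words mkseq w n, n ∈ ℕ (pairwise distinct), so
   "finitely many prefixes in L" means: eventually no prefix is in L. *)
Definition Sigma02 (C : Type) (W : (nat -> C) -> Prop) : Prop :=
  exists L : seq C -> Prop,
    forall w, W w <-> exists N, forall n, N <= n -> ~ L (mkseq w n).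

Definition prefix_independent (C : Type) (W : (nat -> C) -> Prop) : Prop :=
  forall (u : seq C) (w : nat -> C), W (prepend u w) <-> W w.

(* The letter eps is encoded as None, colours c as Some c. *)

Definition fproj (C : Type) (w : nat -> option C) (n : nat) : seq C :=
  pmap id (mkseq w n).

Definition inf_noneps (C : Type) (w : nat -> option C) : Prop :=
  forall N, exists n, N <= n /\ w n <> None.

(* W^eps: the eps-free projection w_C is infinite and in W, or it is finite
   and can be extended by some w' ∈ C^omega into W. In the infinite case, v is
   the projection iff every finite projection of a prefix is a prefix of v. *)
Definition Weps (C : Type) (W : (nat -> C) -> Prop) (w : nat -> option C) : Prop :=
  (inf_noneps w /\
     exists v : nat -> C,
       (forall n, fproj w n = mkseq v (size (fproj w n))) /\ W v)
  \/
  (exists N, (forall n, N <= n -> w n = None) /\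
     exists w' : nat -> C, W (prepend (fproj w N) w')).

Record graph (A : Type) := Graph {
  vert :> Type;
  edge : vert -> A -> vert -> Prop;
  no_sink : forall v, exists a v', edge v a v'
}.
Arguments edge {A g} _ _ _.

Definition is_strategy (A : Type) (G : graph A) (VE : G -> Prop) (v0 : G)
  (S : graph A) (pi : S -> G) (s0 : S) : Prop :=
  [/\ forall s a s', edge s a s' -> edge (pi s) a (pi s'),
      pi s0 = v0 &
      forall (v : G) (a : A) (v' : G), ~ VE v -> edge v a v' ->
        forall s : S, pi s = v -> exists s' : S, pi s' = v' /\ edge s a s'].

Definition winning (A : Type) (S : graph A) (s0 : S) (Obj : (nat -> A) -> Prop) : Prop :=
  forall (p : nat -> S) (c : nat -> A),
    p 0 = s0 -> (forall n, edge (p n) (c n) (p n.+1)) -> Obj c.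

(* existence of a winning eps-strategy with memory <= m in the game
   (G, VE, v0, W^eps): vertex set of S is a subset {x | P x} of V(G) x M,
   pi (v, m) = v, and eps-edges preserve the memory component. *)
Definition has_winning_eps_strategy (C : Type) (W : (nat -> C) -> Prop)
  (G : graph (option C)) (VE : G -> Prop) (v0 : G) (m : nat) : Prop :=
  exists (M : finType) (P : (G * M)%type -> Prop)
         (ES : {x | P x} -> option C -> {x | P x} -> Prop)
         (hns : forall s, exists a s', ES s a s')
         (s0 : {x | P x}),
    let S := @Graph (option C) {x | P x} ES hns in
    [/\ #|M| <= m,
        @is_strategy (option C) G VE v0 S (fun s : S => (proj1_sig s).1) (s0 : S),
        (forall s s' : S, edge s None s' -> (proj1_sig s).2 = (proj1_sig s').2) &
        @winning (option C) S (s0 : S) (Weps W)].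

Definition eps_memory_le (C : Type) (W : (nat -> C) -> Prop) (m : nat) : Prop :=
  forall (G : graph (option C)) (VE : G -> Prop) (v0 : G),
    (exists (S : graph (option C)) (pi : S -> G) (s0 : S),
        is_strategy VE v0 pi s0 /\ winning s0 (Weps W)) ->
    has_winning_eps_strategy W VE v0 m.

(* Main.v *)
Require Import Defs.
From mathcomp Require Import all_boot.
From mathcomp Require Import boolp wochoice.

(* Fix a strategy S winning for the union and write s =c=> s' if S has a path
   from s to s' whose colours are epsilons followed by c. By a Baire category
   argument every nonempty set of states of S contains a state from which all
   =c=>-paths inside the set satisfy one single W i. Peeling off such a state
   together with its descendants, transfinitely often, yields well-ordered
   layers: =c=>-edges never go up, and paths inside a layer satisfy one W i.

   For each layer X consider the game in which Eve, at a vertex v of G, commits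
   to a state s of X that reaches a preimage of v by epsilon-edges, after which
   Adam picks a move of s inside X (or moves silently to any vertex that s
   represents). Eve wins it, hence with an epsilon-strategy of memory m, and
   from all vertices at once since an initial Adam vertex leads to all of them.

   In G, Eve plays at (v, k) according to the least layer whose
   epsilon-strategy contains (v, k). Every move either stays inside this
   strategy or decreases the least layer, so the layer is eventually constant.
   Committing to s rather than to the preimage of v makes this sound for
   epsilon-moves, which must keep k: they remain within the moves of s. *)

Set Implicit Arguments. Unset Strict Implicit. Unset Printing Implicit Defensive.


(** * Dependent choice, well-orders and Cantor's diagonal argument *)

Lemma dependent_choice_in (X : Type) (P : X -> Prop) (R : X -> X -> Prop)
    (x0 : X) :
  P x0 -> (forall x, P x -> exists y, P y /\ R x y) ->
  exists f : nat -> X, [/\ f 0 = x0, forall n, P (f n) & forall n, R (f n) (f n.+1)].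
Proof.
move=> Px0 ext.
have /choice[g gP] : forall x, exists y, P x -> P y /\ R x y.
  move=> x; have [Px|nPx] := EM (P x); last by exists x.
  by have [y ?] := ext x Px; exists y.
have Pf n : P (iter n g x0) by elim: n => //= n IHn; exact: (gP _ IHn).1.
by exists (fun n => iter n g x0); split=> // n; exact: (gP _ (Pf n)).2.
Qed.

(** The well-ordering principle yields a relation [R] under which every nonempty set has a unique
    least element. Applied to sets of one, two and three elements this gives the order axioms; the
    strict order is the negated converse of [R]. *)
Lemma prop_well_order (I : Type) :
  exists lt : I -> I -> Prop,
    [/\ well_founded lt, forall x y z, lt x y -> lt y z -> lt x z &
        forall x y, lt x y \/ x = y \/ lt y x].
Proof.
have [R woR] := well_ordering_principle {classic I}.
have minR (A : I -> Prop) : (exists x, A x) ->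
    exists x, A x /\ forall y, A y -> R x y.
  move=> [a Aa]; have [|x [[Ax minx] _]] := woR (fun x : I => `[< A x >]).
    by exists a; apply/asboolP.
  by exists x; split=> [|y Ay]; [apply/asboolP | apply/minx/asboolP].
have antiR x y : R x y -> R y x -> x = y.
  move=> Rxy Ryx.
  have inP z : reflect (z = x \/ z = y) (z \in (fun z : I => `[< z = x \/ z = y >])).
    exact: asboolP.
  have Rrefl (u : I) : R u u by have [v [<- ->]] := minR (fun z => z = u) (ex_intro _ u erefl).
  have [|z [_ uz]] := woR (fun z : I => `[< z = x \/ z = y >]).
    by exists x; apply/inP; left.
  rewrite -(uz x) ?(uz y) //; split; try by apply/inP; auto.
    by move=> t /inP[] ->.
  by move=> t /inP[] ->.
have totR x y : R x y \/ R y x.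
  have [|z [[->|->] zP]] := minR (fun z => z = x \/ z = y); first by exists x; left.
    by left; apply: zP; right.
  by right; apply: zP; left.
exists (fun x y => ~ R y x); split.
- move=> x; apply: contrapT => nx.
  have [|z [nz zP]] := minR (fun z => ~ Acc (fun x y => ~ R y x) z); first by exists x.
  by apply: nz; split=> y nRzy; apply: contrapT => /zP.
- move=> x y z nRyx nRzy Rzx.
  have [|t [[->|[->|->]] tP]] := minR (fun t => t = x \/ t = y \/ t = z).
  + by exists x; left.
  + have Rxy : R x y by apply: tP; auto.
    have /antiR xz : R x z by apply: tP; auto.
    by rewrite -(xz Rzx) in nRzy.
  + by apply: nRyx; apply: tP; auto.
  + by apply: nRzy; apply: tP; auto.
- move=> x y; have [Rxy|nRxy] := EM (R x y); last by auto.
  have [Ryx|nRyx] := EM (R y x); last by auto.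
  by right; left; apply: antiR.
Qed.

Lemma wf_least (I : Type) (lt : I -> I -> Prop) (A : I -> Prop) :
  well_founded lt -> (exists x, A x) ->
  exists x, A x /\ forall y, A y -> ~ lt y x.
Proof.
move=> wf [x]; elim/(well_founded_ind wf): x => x IHx Ax.
have [[y [Ay yx]]|] := EM (exists y, A y /\ lt y x); first exact: (IHx y).
by move=> none; exists x; split=> // y Ay yx; apply: none; exists y.
Qed.

(** Diagonal argument on the values [g A] lying outside [A]. It will force the transfinite peeling
    to exhaust the states. *)
Lemma no_injection_powerset (T : Type) (g : (T -> Prop) -> T) : ~ injective g.
Proof.
move=> injg; pose D t := exists A, t = g A /\ ~ A t.
have [DgD|nDgD] := EM (D (g D)); last by apply: (nDgD); exists D.
by have [A [/injg <-]] := DgD.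
Qed.

(** * Infinite words *)

Lemma prependE (C : Type) (c : nat -> C) n :
  prepend (mkseq c n) (fun k => c (n + k)) = c.
Proof.
elim: n c => [|n IHn] c; first by apply/funext.
rewrite /mkseq -add1n iotaD /= -[X in iota X n]addn0 iotaDl -map_comp /=.
by apply/funext => -[|k] //=; have /(congr1 (@^~ k)) := IHn (c \o S).
Qed.

Lemma mkseq_prepend (C : Type) (u : seq C) (c : nat -> C) n :
  mkseq (prepend u c) (size u + n) = u ++ mkseq c n.
Proof.
elim: u => //= a u IHu; rewrite -IHu addSn /mkseq /=; congr cons.
by rewrite -[X in iota X _]addn0 iotaDl -map_comp.
Qed.

Lemma mkseq_cons (C : Type) (c : nat -> C) n : mkseq c n.+1 = c 0 :: mkseq (c \o S) n.
Proof. by rewrite /mkseq /= -[X in iota X n]addn0 iotaDl -map_comp. Qed.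

Lemma prefix_independent_shift (C : Type) (W : (nat -> C) -> Prop) c n :
  prefix_independent W -> W (fun k => c (n + k)) <-> W c.
Proof. by move=> piW; rewrite -{2}(prependE c n) piW. Qed.

Definition is_proj (C : Type) (e : nat -> option C) (v : nat -> C) :=
  forall n, fproj e n = mkseq v (size (fproj e n)).

Lemma fprojS (C : Type) (e : nat -> option C) n :
  fproj e n.+1 = (if e 0 is Some a then [:: a] else [::]) ++ fproj (e \o S) n.
Proof. by rewrite /fproj mkseq_cons /=; case: (e 0). Qed.

Lemma fprojSr (C : Type) (e : nat -> option C) n :
  fproj e n.+1 = fproj e n ++ (if e n is Some a then [:: a] else [::]).
Proof. by rewrite /fproj mkseqS -cats1 pmap_cat /=; case: (e n). Qed.

Lemma fproj_prefix (C : Type) (e : nat -> option C) n k :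
  n <= k -> exists u, fproj e k = fproj e n ++ u.
Proof.
move/subnK <-; elim: (k - n) => [|j [u IHj]]; first by exists [::]; rewrite cats0.
by rewrite addSn fprojSr IHj -catA; eexists.
Qed.

Lemma inf_noneps_size (C : Type) (e : nat -> option C) :
  inf_noneps e -> forall k, exists n, k < size (fproj e n).
Proof.
move=> inf; elim=> [|k [n kn]].
  have [n [_ en]] := inf 0; exists n.+1; rewrite fprojSr size_cat.
  by case: (e n) en => //= a _; rewrite addn1.
have [l [nl el]] := inf n; exists l.+1; have [u ul] := fproj_prefix e nl.
rewrite fprojSr size_cat; case: (e l) el => //= a _; rewrite addn1 ltnS.
by rewrite ul size_cat (leq_trans kn) ?leq_addr.
Qed.

Lemma is_proj_exists (C : Type) (e : nat -> option C) :
  inf_noneps e -> exists v, is_proj e v.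
Proof.
move=> inf; have [N NP] := choice (inf_noneps_size inf).
have [n0 [_ en0]] := inf 0; case: (e n0) en0 => // a0 _.
exists (fun k => nth a0 (fproj e (N k)) k) => n.
apply: (@eq_from_nth _ a0) => [|k kn]; first by rewrite size_mkseq.
rewrite nth_mkseq //; have [le|/ltnW le] := leqP n (N k).
  by have [u ->] := fproj_prefix e le; rewrite nth_cat kn.
by have [u ->] := fproj_prefix e le; rewrite nth_cat NP.
Qed.

Lemma is_proj_unique (C : Type) (e : nat -> option C) v v' :
  inf_noneps e -> is_proj e v -> is_proj e v' -> v = v'.
Proof.
move=> inf pv pv'; apply/funext => k; have [n kn] := inf_noneps_size inf k.
by rewrite -(nth_mkseq (v k) v kn) -(nth_mkseq (v k) v' kn) -pv -pv'.
Qed.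

Lemma inf_noneps_shift (C : Type) (e : nat -> option C) :
  inf_noneps (e \o S) <-> inf_noneps e.
Proof.
split=> inf N; first by have [n [Nn en]] := inf N; exists n.+1; rewrite ltnW.
by have [[|n] [// Nn en]] := inf N.+1; exists n.
Qed.

(** A finite projection is a prefix that prefix independence erases, so in that case only
    nonemptiness of [W] is left. *)
Lemma WepsE (C : Type) (W : (nat -> C) -> Prop) e :
  prefix_independent W ->
  Weps W e <->
  (inf_noneps e /\ exists v, is_proj e v /\ W v) \/
  (~ inf_noneps e /\ exists w, W w).
Proof.
move=> piW; split=> [[H|[N [eN [w Ww]]]]|[H|[ninf [w Ww]]]]; [by left| | by left |].
  right; split; last by exists w; rewrite -(piW (fproj e N)).
  by move=> /(_ N)[n [/eN ->]].
right; have /existsNP[N nN] := ninf; exists N; split=> [n Nn|].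
  by apply: contrapT => en; apply: nN; exists n.
by exists w; rewrite piW.
Qed.

Lemma Weps_shift1 (C : Type) (W : (nat -> C) -> Prop) e :
  prefix_independent W -> Weps W (e \o S) <-> Weps W e.
Proof.
move=> piW; rewrite !WepsE // inf_noneps_shift.
suff H : (exists v, is_proj (e \o S) v /\ W v) <-> (exists v, is_proj e v /\ W v).
  by rewrite H.
split=> [[v [pv Wv]]|[v [pv Wv]]].
  exists (prepend (if e 0 is Some a then [:: a] else [::]) v); rewrite piW.
  split=> // -[//|n]; rewrite fprojS size_cat mkseq_prepend; congr (_ ++ _).
  exact: pv.
case e0: (e 0) => [a|].
  exists (v \o S); split; last by rewrite (prefix_independent_shift v 1 piW).
  by move=> n; have := pv n.+1; rewrite fprojS e0 /= mkseq_cons => -[].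
by exists v; split=> // n; have := pv n.+1; rewrite fprojS e0.
Qed.

Lemma Weps_shift (C : Type) (W : (nat -> C) -> Prop) e n :
  prefix_independent W -> Weps W (fun k => e (n + k)) <-> Weps W e.
Proof.
move=> piW; elim: n e => [|n IHn] e.
  by rewrite (_ : (fun k => _) = e) //; apply/funext.
by rewrite -(Weps_shift1 e) // -(IHn (e \o S)).
Qed.

(** Interleaved epsilons do not change the projection. This is used to read one move in [G] as two
    moves of a layer game, the first of them silent. *)
Lemma Weps_undouble (C : Type) (W : (nat -> C) -> Prop) e :
  prefix_independent W ->
  Weps W (fun n => if odd n then e n./2 else None) -> Weps W e.
Proof.
move=> piW; set d := fun n => _.
have pd n : fproj d n.*2 = fproj e n.
  elim: n => // n IHn.
  by rewrite doubleS !fprojSr IHn /d /= odd_double cats0 uphalf_double.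
have infd : inf_noneps d <-> inf_noneps e.
  split=> inf N.
    have [n [Nn]] := inf N.*2; rewrite /d; case: ifP => // _ en.
    by exists n./2; rewrite geq_half_double.
  have [n [Nn en]] := inf N; exists n.*2.+1; rewrite /d /= odd_double uphalf_double.
  by rewrite (leq_trans Nn) // -addnn -addnS leq_addr.
rewrite !WepsE // infd; case=> [[inf [v [pv Wv]]]|]; [left|by right].
by split=> //; exists v; split=> // n; rewrite -pd; apply: pv.
Qed.


(** * Infinite paths *)

Fixpoint run (X A : Type) (Q : X -> A -> X -> Prop) (x : X) (l : seq A) (y : X) : Prop :=
  if l is a :: r then exists x', Q x a x' /\ run Q x' r y else x = y.

Lemma run_path (X A : Type) (Q : X -> A -> X -> Prop) (p : nat -> X) (c : nat -> A) n :
  (forall k, Q (p k) (c k) (p k.+1)) -> run Q (p 0) (mkseq c n) (p n).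
Proof.
elim: n p c => [//|n IHn] p c Qp; rewrite mkseq_cons /=.
by exists (p 1); split=> //; apply: (IHn (p \o S) (c \o S)) => k; apply: Qp.
Qed.

Lemma concat_runs (X A : Type) (Q : X -> A -> X -> Prop) (t : nat -> X)
    (w : nat -> seq A) :
  (forall n, 0 < size (w n)) -> (forall n, run Q (t n) (w n) (t n.+1)) ->
  exists (p : nat -> X) (c : nat -> A),
    [/\ p 0 = t 0, forall n, Q (p n) (c n) (p n.+1) &
        forall n, mkseq c (size (flatten (mkseq w n))) = flatten (mkseq w n)].
Proof.
move=> wpos rw; pose flat n := flatten (mkseq w n).
have flatS n : flat n.+1 = flat n ++ w n by rewrite /flat mkseqS flatten_rcons.
(* state (n, x, l): at x, with l still to be read before reaching t n *)
pose P (s : nat * X * seq A) := 0 < size s.2 /\ run Q s.1.2 s.2 (t s.1.1).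
pose R (s s' : nat * X * seq A) := exists a, Q s.1.2 a s'.1.2 /\
  exists r, s.2 = a :: r /\ ((s'.1.1 = s.1.1 /\ s'.2 = r) \/
                             [/\ r = [::], s'.1.1 = s.1.1.+1 & s'.2 = w s.1.1]).
(* The index starts at 1 because [w 0] leads from [t 0] to [t 1]. *)
have [||f [f0 fP fR]] := @dependent_choice_in _ P R (1, t 0, w 0).
- by split; [exact: wpos | exact: rw].
- move=> [[n x] [|a r]] [//= _ [y [Qy ry]]]; case: r ry => [|b r] /= ry.
    exists (n.+1, y, w n); split; last by exists a; split=> //; exists [::]; split=> //; right.
    by split=> /=; rewrite ?ry; [exact: wpos | exact: rw].
  exists (n, y, b :: r); split; first by split.
  by exists a; split=> //; exists (b :: r); split=> //; left.
have [c cP] := choice fR.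
exists (fun n => (f n).1.2), c; split; [by rewrite f0 | by move=> n; case: (cP n) |].
have inv k : mkseq c k ++ (f k).2 = flat (f k).1.1.
  elim: k => [|k IHk]; first by rewrite f0 /= /flat /= cats0.
  have [_ [r [fk2 H]]] := cP k; rewrite fk2 in IHk; rewrite mkseqS cat_rcons.
  case: H => [[-> ->] //|[r0 -> ->]]; rewrite r0 in IHk.
  by rewrite flatS -IHk -catA.
have mono n k : n <= k -> exists u, flat k = flat n ++ u.
  move/subnK <-; elim: (k - n) => [|j [u IHj]]; first by exists [::]; rewrite cats0.
  by rewrite addSn flatS IHj -catA; eexists.
move=> n; rewrite -/(flat n); set k := size (flat n).
(* The first case is impossible: the [k] letters read and the nonempty remainder would together fit
   into [flat n], which has length [k]. *)
have [le|/ltnW/mono[u fu]] := leqP (f k).1.1 n.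
  have [u fu] := mono _ _ le; have := congr1 size fu.
  rewrite -inv !size_cat size_mkseq -/k => ks.
  have : k + size (f k).2 <= k by rewrite [leqRHS]ks leq_addr.
  by rewrite -[leqRHS]addn0 leq_add2l leqNgt; have [->] := fP k.
have := congr1 (take k) (inv k).
by rewrite fu take_size_cat ?size_mkseq // take_size_cat.
Qed.

(** Each letter is tagged with the vertex at which it is read. The projection [v] of the tagged word
    then carries both the contracted path and its colours. *)
Lemma contract_path (T C : Type) (step : T -> C -> T -> Prop) (f : nat -> T)
    (e : nat -> option C) :
  inf_noneps e ->
  (forall n, if e n is Some c then step (f n) c (f n.+1) else f n.+1 = f n) ->
  exists (p : nat -> T) (c : nat -> C),
    [/\ forall k, step (p k) (c k) (p k.+1), is_proj e c & forall k, exists n, p k = f n].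
Proof.
move=> inf fe; pose e' n := omap (pair (f n)) (e n).
have inf' : inf_noneps e'.
  move=> N; have [n [Nn en]] := inf N; exists n; split=> //.
  by rewrite /e'; case: (e n) en.
have [v pv] := is_proj_exists inf'.
have ee' n : fproj e n = map snd (fproj e' n).
  by elim: n => // n IHn; rewrite !fprojSr map_cat IHn /e'; case: (e n).
have inv n : [/\ forall k, k.+1 < size (fproj e' n) -> step (v k).1 (v k).2 (v k.+1).1,
    forall k, k.+1 = size (fproj e' n) -> step (v k).1 (v k).2 (f n)
  & forall k, k < size (fproj e' n) -> exists j, (v k).1 = f j].
  elim: n => [//|n [IH1 IH2 IH3]].
  have := pv n.+1; rewrite fprojSr /e'; have := fe n.
  case en: (e n) => [c|] /= => [fS|->]; last by rewrite cats0.
  rewrite size_cat /= addn1 mkseqS -/e' -pv cats1 => /rcons_inj[vn].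
  split=> k; rewrite ?ltnS.
  - by rewrite leq_eqVlt => /predU1P[kn|/IH1//]; rewrite kn -vn; apply: IH2.
  - by case=> ->; rewrite -vn.
  - by rewrite leq_eqVlt => /predU1P[->|/IH3//]; rewrite -vn; exists n.
exists (fst \o v), (snd \o v); split=> [k|n|k].
- by have [n kn] := inf_noneps_size inf' k.+1; have [H _ _] := inv n; apply: H.
- by rewrite ee' size_map pv size_mkseq /mkseq -map_comp.
- by have [n kn] := inf_noneps_size inf' k; have [_ _ H] := inv n; apply: H.
Qed.

(** * Layers *)

(* Otherwise, as every path may be continued into one outside [W i], extending
   a finite path for each [i] infinitely often by a prefix of the language that
   witnesses that [W i] is Sigma_2^0 yields a path outside all the [W i]. *)
Lemma exists_uniform_vertex (C T : Type) (step : T -> C -> T -> Prop)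
    (W : nat -> (nat -> C) -> Prop) (A : T -> Prop) :
  (forall i, prefix_independent (W i)) -> (forall i, Sigma02 (W i)) ->
  (exists s, A s) ->
  (forall p c, (forall n, A (p n)) -> (forall n, step (p n) (c n) (p n.+1)) ->
    exists i, W i c) ->
  exists s i, A s /\ forall p c, p 0 = s -> (forall n, A (p n)) ->
    (forall n, step (p n) (c n) (p n.+1)) -> W i c.
Proof.
move=> piW /choice[L LP] [s0 As0] winA; apply: contrapT => none.
pose Q x c y := [/\ step x c y, A x & A y].
have ext i t u : A t -> exists w t',
    [/\ 0 < size w, run Q t w t', A t' & L i (u ++ w)].
  move=> At; apply: contrapT => next; apply: none; exists t, i; split=> // p c p0 Ap sp.
  apply/(piW i u)/LP; exists (size u).+1 => n un Ln; apply: next.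
  exists (mkseq c (n - size u)), (p (n - size u)); split=> //.
  - by rewrite size_mkseq subn_gt0.
  - by rewrite -p0; apply: run_path.
  - by rewrite -mkseq_prepend subnKC // ltnW.
pose P (s : nat * T * seq C) := A s.1.2.
(* Stage [n] serves the index [logn 2 n], so that every index is served infinitely often. *)
pose R (s s' : nat * T * seq C) := exists w, [/\ s'.1.1 = s.1.1.+1, 0 < size w,
   run Q s.1.2 w s'.1.2, s'.2 = s.2 ++ w & L (logn 2 s.1.1) s'.2].
have [//||f [f0 fP fR]] := @dependent_choice_in _ P R (0, s0, [::]).
  move=> [[n t] u] At; have [w [t' [? ? ? ?]]] := ext (logn 2 n) t u At.
  by exists (n.+1, t', u ++ w); split=> //; exists w.
have [w wP] := choice fR.
have fn n : (f n).1.1 = n.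
  by elim: n => [|n IHn]; [rewrite f0 | have [-> _ _ _ _] := wP n; rewrite IHn].
have fu n : (f n).2 = flatten (mkseq w n).
  elim: n => [|n IHn]; first by rewrite f0.
  by have [_ _ _ -> _] := wP n; rewrite mkseqS flatten_rcons IHn.
have szu n : n <= size (f n).2.
  elim: n => // n IHn; have [_ w0 _ -> _] := wP n; rewrite size_cat.
  by rewrite -addn1 leq_add.
have [||p [c [p0 Qp cw]]] := @concat_runs _ _ Q (fun n => (f n).1.2) w.
- by move=> n; have [] := wP n.
- by move=> n; have [] := wP n.
have [||i /LP[N LN]] := winA p c; try by move=> n; have [] := Qp n.
(* A stage serving [i], as the second factor is odd, and late enough to contradict [LN]. *)
pose n := 2 ^ i * N.*2.+1.
have Nn : N <= n.
  rewrite (@leq_trans N.*2.+1) ?leq_pmull ?expn_gt0 //.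
  by rewrite -addnn -addnS leq_addr.
apply: (LN (size (f n.+1).2)); first by rewrite (leq_trans Nn) ?(leq_trans _ (szu _)).
rewrite fu cw -fu; have [_ _ _ _] := wP n; rewrite fn /n lognM ?expn_gt0 //.
by rewrite pfactorK // (@logn_coprime 2) ?addn0 // coprime2n /= odd_double.
Qed.

(** One peeling step, with [D] already removed: [N] collects what a uniform vertex reaches outside
    [D]. A path in [N] extends backwards to that vertex, and prefix independence discards the
    extension. *)
Lemma uniform_part (C T : Type) (step : T -> C -> T -> Prop)
    (W : nat -> (nat -> C) -> Prop) (good : T -> Prop) (D : T -> Prop) :
  (forall i, prefix_independent (W i)) -> (forall i, Sigma02 (W i)) ->
  (exists i w, W i w) ->
  (forall s c s', good s -> step s c s' -> good s') ->
  (forall p c, good (p 0) -> (forall n, step (p n) (c n) (p n.+1)) ->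
    exists i, W i c) ->
  exists N : T -> Prop,
    [/\ forall s, N s -> good s /\ ~ D s,
        (exists s, good s /\ ~ D s) -> exists s, N s,
        forall s c s', N s -> step s c s' -> D s' \/ N s' &
        exists i, (exists w, W i w) /\
          forall p c, (forall n, N (p n)) -> (forall n, step (p n) (c n) (p n.+1)) ->
            W i c].
Proof.
move=> piW sW [j [w Ww]] goodS win; pose A s := good s /\ ~ D s.
have [A0|nA] := EM (exists s, A s); last first.
  exists (fun=> False); split=> //; exists j; split; first by exists w.
  by move=> p c /(_ 0).
have winA p c : (forall n, A (p n)) -> (forall n, step (p n) (c n) (p n.+1)) ->
    exists i, W i c by move=> /(_ 0)[g _]; apply: win.
have [l [i [Al lP]]] := exists_uniform_vertex piW sW A0 winA.
pose Q x c y := [/\ step x c y, A x & A y].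
have runA u x y : A x -> run Q x u y -> A y.
  by elim: u x => [x Ax <-//|a u IHu] x Ax [z [[_ _ Az] /IHu]]; apply.
exists (fun s => exists u, run Q l u s); split.
- by move=> s [u /runA]; apply.
- by exists l, [::].
- move=> s c s' [u ru] sc; have As := runA _ _ _ Al ru.
  have [Ds'|nDs'] := EM (D s'); [by left | right]; exists (rcons u c).
  have As' : A s' by split=> //; apply: goodS sc; case: As.
  elim: u {+}l {lP} Al ru => [x Ax /= ->|a u IHu x Ax /= [y [Qy ry]]].
    by exists s'.
  by exists y; split=> //; apply: IHu => //; case: Qy.
have main p c : (forall n, exists u, run Q l u (p n)) ->
    (forall n, step (p n) (c n) (p n.+1)) -> W i c.
  move=> Np sp; have [u ru] := Np 0.
  have Ap n : A (p n) by have [u' /runA] := Np n; apply.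
  apply/(piW i u).
  elim: u {+}l {lP} (lP) Al ru => [x lP Ax /= xp|a u IHu x lP Ax /= [y [Qy ry]]].
    exact: (lP p c).
  apply: (piW i [:: a] (prepend u c)).2; apply: (IHu y) => //; last by case: Qy.
  move=> p' c' p'0 Ap' sp'; apply/(piW i [:: a]).
  by apply: (lP (fun n => if n is k.+1 then p' k else x)) => [//|[|n]|[|n]] //=;
    [rewrite p'0; case: Qy].
(* If [W i] is empty, then [N] contains no infinite path and any nonempty objective serves. *)
have [Wi|nWi] := EM (exists w', W i w'); first by exists i.
by exists j; split=> [|p c Np sp]; [exists w | case: nWi; exists c; apply: main Np sp].
Qed.

Lemma layering (C T : Type) (step : T -> C -> T -> Prop)
    (W : nat -> (nat -> C) -> Prop) (good : T -> Prop) :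
  (forall i, prefix_independent (W i)) -> (forall i, Sigma02 (W i)) ->
  (exists i w, W i w) ->
  (forall s c s', good s -> step s c s' -> good s') ->
  (forall p c, good (p 0) -> (forall n, step (p n) (c n) (p n.+1)) ->
    exists i, W i c) ->
  exists (I : Type) (lt : I -> I -> Prop) (L : I -> T -> Prop),
    [/\ well_founded lt /\ (forall x y z, lt x y -> lt y z -> lt x z),
        forall x y, lt x y \/ x = y \/ lt y x,
        forall s, good s -> exists x, L x s,
        forall x s c s', L x s -> step s c s' -> exists y, (y = x \/ lt y x) /\ L y s' &
        forall x, exists i, (exists w, W i w) /\
          forall p c, (forall n, L x (p n)) -> (forall n, step (p n) (c n) (p n.+1)) ->
            W i c].
Proof.
move=> piW sW neW goodS win.
have [next nextP] := choice (fun D => uniform_part D piW sW neW goodS win).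
(* The layers are indexed by the powerset of [T]: if a good state were never peeled, every layer
   would be nonempty, and picking one state from each of these disjoint layers would inject the
   powerset into [T]. *)
have [lt [wf tr tot]] := prop_well_order (T -> Prop).
pose below x (rec : forall y, lt y x -> T -> Prop) s := exists y (h : lt y x), rec y h s.
pose L := Fix wf (fun=> T -> Prop) (fun x rec => next (below x rec)).
have LE x : L x = next (fun s => exists y, lt y x /\ L y s).
  rewrite /L Fix_eq -/L => [|y g g' gg'].
    congr next; apply/funext => s; apply: propext.
    by split=> [[y [h Ly]]|[y [h Ly]]]; exists y; [split | exists h].
  by congr next; congr below; apply: functional_extensionality_dep => z; apply/funext.
exists (T -> Prop), lt, L; split=> //.
- move=> s gs; apply: contrapT => nL.
  have /choice[g gP] : forall x, exists t, L x t.
    move=> x; rewrite LE; have [_ H _ _] := nextP (fun s => exists y, lt y x /\ L y s).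
    by apply: H; exists s; split=> // -[y [_ Ly]]; apply: nL; exists y.
  have nlt x y : g x = g y -> ~ lt x y.
    move=> gxy xy; have := gP y; rewrite LE.
    have [H _ _ _] := nextP (fun s => exists z, lt z y /\ L z s).
    by move=> /H[_]; apply; exists x; rewrite -gxy.
  apply: (@no_injection_powerset _ g) => x y gxy.
  by have [/nlt|[//|/nlt]] := tot x y; rewrite gxy => /(_ erefl).
- move=> x s c s'; rewrite LE; have [_ _ H _] := nextP (fun s => exists y, lt y x /\ L y s).
  move=> Ls /(H _ _ _ Ls)[[y [yx Ly]]|Nx]; first by exists y; auto.
  by exists x; rewrite LE; auto.
- by move=> x; rewrite LE; case: (nextP (fun s => exists y, lt y x /\ L y s)).
Qed.


(** * Strategies with memory ['I_m] *)

(** The memory is the same set ['I_m] for every strategy, so that strategies of different layers can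
    be superposed, and plays are won from every position in [P] rather than from one initial
    position. *)
Definition mem_strategy (C : Type) (W : (nat -> C) -> Prop) (G : graph (option C))
    (VE : G -> Prop) (m : nat) (P : G -> 'I_m -> Prop)
    (E : G -> 'I_m -> option C -> G -> 'I_m -> Prop) : Prop :=
  [/\ forall v k a v' k', E v k a v' k' ->
        [/\ P v' k', edge v a v' & a = None -> k = k'],
      forall v k, P v k -> exists a v' k', E v k a v' k',
      forall v k a v', P v k -> ~ VE v -> edge v a v' -> exists k', E v k a v' k' &
      forall (q : nat -> G) (r : nat -> 'I_m) e, P (q 0) (r 0) ->
        (forall n, E (q n) (r n) (e n) (q n.+1) (r n.+1)) -> Weps W e].

Lemma eps_strategy_mem_strategy (C : Type) (W : (nat -> C) -> Prop)
    (G : graph (option C)) (VE : G -> Prop) (v0 : G) (m : nat) :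
  prefix_independent W -> has_winning_eps_strategy W VE v0 m ->
  exists P E, @mem_strategy C W G VE m P E /\ exists k, P v0 k.
Proof.
move=> piW [M [P0 [ES [hns [s0 [leM [hom s0v adam] epsM win]]]]]].
pose key (s : {x | P0 x}) : G * 'I_m :=
  ((sval s).1, widen_ord leM (enum_rank (sval s).2)).
have key_inj : injective key.
  move=> [[v k] Pvk] [[v' k'] Pvk'] [/= ee /ord_inj/enum_rank_inj ek]; subst v' k'.
  by rewrite (Prop_irrelevance Pvk Pvk').
(* The given strategy wins only from [s0]; restricting to states from which every path wins makes it
   win everywhere. *)
pose good s := forall p c, p 0 = s -> (forall n, ES (p n) (c n) (p n.+1)) -> Weps W c.
have goodS s a s' : good s -> ES s a s' -> good s'.
  move=> gs Es p c p0 Ep.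
  have := gs (fun n => if n is k.+1 then p k else s) (fun n => if n is k.+1 then c k else a).
  move=> /(_ erefl) H; apply/(Weps_shift1 (fun n => if n is k.+1 then c k else a) piW).
  by apply: H => -[|n] //=; rewrite p0.
exists (fun v k => exists s, key s = (v, k) /\ good s).
exists (fun v k a v' k' => exists s s',
  [/\ key s = (v, k), key s' = (v', k'), good s & ES s a s']).
split; last by exists (key s0).2, s0; split; [rewrite -s0v | exact: win].
split.
- move=> v k a v' k' [s [s' [[<- <-] [<- <-] gs Es]]]; split.
  + by exists s'; split=> //; apply: goodS Es.
  + exact: hom Es.
  + by move=> aN; rewrite (epsM s s') // -aN.
- move=> v k [s [ks gs]]; have [a [s' Es]] := hns s.
  by exists a, (key s').1, (key s').2, s, s'; split=> //; case: (key s').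
- move=> v k a v' [s [ks gs]] nv vv'.
  have [s' [s'v Es]] := adam v a v' nv vv' s (congr1 fst ks).
  by exists (key s').2, s, s'; split=> //; rewrite /key s'v.
- move=> q r e [s [ks gs]] Eq; have [p pP] := choice Eq.
  apply: (gs p); first by have [s' [kp _ _ _]] := pP 0; apply: key_inj; rewrite kp ks.
  move=> n; have [s' [kp ks' _ Es']] := pP n; have [s'' [kp' _ _ _]] := pP n.+1.
  by rewrite (key_inj (p n.+1) s') // kp' ks'.
Qed.

(** * The game of a layer *)

Inductive eps_reach (C : Type) (S : graph (option C)) (s : S) : S -> Prop :=
| eps_refl : eps_reach s s
| eps_step d d' : eps_reach s d -> edge d None d' -> eps_reach s d'.

Definition cstep (C : Type) (S : graph (option C)) (s : S) (c : C) (s' : S) : Prop :=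
  exists d, eps_reach s d /\ edge d (Some c) s'.

Inductive layer_vertex (V T : Type) := Init | Ev of V | Ad of T.
Arguments Init {V T}. Arguments Ev {V T}. Arguments Ad {V T}.

Section LayerGame.
Variables (C : Type) (G S : graph (option C)) (pi : S -> G) (X : S -> Prop).
Hypothesis X_nonempty : exists s, X s.

Definition represents (s : S) (v : G) := X s /\ exists d, eps_reach s d /\ pi d = v.

(* At [v], Eve commits to a state [s] of the layer [X] that represents [v];
   Adam then chooses a move of [s] that remains in [X]. *)
Definition layer_edge (y : layer_vertex G S) (a : option C) (z : layer_vertex G S) : Prop :=
  match y, a, z with
  | Init, None, Ev v => exists s, represents s v
  | Ev v, None, Ad s => represents s v
  | Ev v, None, Ev v' => ~ (exists s, represents s v) /\ v = v'
  | Ad s, None, Ev v => exists d, eps_reach s d /\ pi d = v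
  | Ad s, Some c, Ev v =>
      exists d d', [/\ eps_reach s d, edge d (Some c) d', X d' & pi d' = v]
  | _, _, _ => False
  end.

(** The loop at an unrepresented [Ev v] is there for this lemma; such vertices cannot be reached
    from [Init]. *)
Lemma layer_no_sink y : exists a z, layer_edge y a z.
Proof.
have [s Xs] := X_nonempty; exists None; case: y => [|v|t].
- by exists (Ev (pi s)), s; split=> //; exists s; split=> //; apply: eps_refl.
- have [[t tv]|no] := EM (exists s, represents s v); first by exists (Ad t).
  by exists (Ev v).
- by exists (Ev (pi t)), t; split=> //; apply: eps_refl.
Qed.

Definition layer_game := Graph layer_no_sink.

Definition layer_eve (y : layer_vertex G S) := if y is Ev _ then True else False.

Let state := {x : S * S | X x.1 /\ eps_reach x.1 x.2}.

(* [(s, d, true)]: Eve is at [pi d] and is going to commit to [s];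
   [(s, d, false)]: Eve is committed to [s]. *)
Let sedge (y : option (state * bool)) (a : option C) (z : option (state * bool)) : Prop :=
  match y, a, z with
  | None, None, Some (_, true) => True
  | Some (x, true), None, Some (x', false) => x = x'
  | Some (x, false), None, Some (x', true) => (sval x).1 = (sval x').1
  | Some (x, false), Some c, Some (x', true) =>
      cstep (sval x).1 c (sval x').1 /\ (sval x').2 = (sval x').1
  | _, _, _ => False
  end.

Let mkstate s d (Xs : X s) (sd : eps_reach s d) : state :=
  exist (fun x => X x.1 /\ eps_reach x.1 x.2) (s, d) (conj Xs sd).

Let sno_sink y : exists a z, sedge y a z.
Proof.
have [s Xs] := X_nonempty; exists None; case: y => [[x []]|].
- by exists (Some (x, false)).
- by exists (Some (x, true)).
- by exists (Some (mkstate Xs (eps_refl s), true)).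
Qed.

Let spi (y : option (state * bool)) : layer_vertex G S :=
  match y with
  | None => Init
  | Some (x, true) => Ev (pi (sval x).2)
  | Some (x, false) => Ad (sval x).1
  end.

(** Eve commits to the state last entered by a coloured move and keeps it during silent moves. The
    committed states thus follow a [cstep]-path in [X]; a play with finitely many colours is won
    because [W] is nonempty. *)
Lemma layer_game_won (W : (nat -> C) -> Prop) :
  prefix_independent W -> (exists w, W w) ->
  (forall p c, (forall n, X (p n)) -> (forall n, cstep (p n) (c n) (p n.+1)) -> W c) ->
  exists (S' : graph (option C)) (pi' : S' -> layer_game) (s0 : S'),
    is_strategy (G := layer_game) layer_eve Init pi' s0 /\ winning s0 (Weps W).
Proof.
move=> piW neW winX; exists (Graph sno_sink), spi, None; split; last first.
  move=> p e p0 pe; apply/Weps_shift1/WepsE => //.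
  have [inf|ninf] := EM (inf_noneps (e \o succn)); [left | by right].
  split=> //; have [s Xs] := X_nonempty.
  (* The default [s] never occurs: the play does not return to [None] after its first move. *)
  pose f n := if p n.+1 is Some (x, _) then (sval x).1 else s.
  have Xf n : X (f n) by rewrite /f; case: (p n.+1) => [[[x []]]|].
  have some n : p n.+1 <> None.
    case: n => [|n] pn.
      by have := pe 0; rewrite p0 pn /=; case: (e 0).
    have := pe n.+1; rewrite pn /=.
    by case: (e n.+1) => [c|]; case: (p n.+1) => [[x []]|].
  have [|q [c [qc ec qf]]] := @contract_path _ _ (@cstep C S) f _ inf.
    move=> n; rewrite /f /comp; have := pe n.+1; have := some n; have := some n.+1.
    case: (p n.+2) => [[x' b']|//] _; case: (p n.+1) => [[x b]|//] _ /=.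
    by case: b; case: (e n.+1) => [c|]; case: b' => //; first [by move-> | by case].
  exists c; split=> //; apply: winX qc => k; have [n ->] := qf k; exact: Xf.
split=> //.
- move=> [[[[s d] /= [Xs sd]] []]|] [c|] [[[[s' d'] /= [Xs' sd']] []]|] //=.
  + by case=> _ ->; split=> //; exists d'; split.
  + by case=> [[u [su uc]] ->]; exists u, s'.
  + by move=> ->; exists d'.
  + by move=> _; exists s'; split=> //; exists d'.
- case=> [|v|s] a [|v'|s'] //=; case: a => [c|] //= nE; try by case: (nE I).
  + move=> [s [Xs [d [sd dv]]]] [[x []]|] // _.
    by exists (Some (mkstate Xs sd, true)); rewrite /= dv.
  + move=> [d [d' [sd dc Xd' d'v]]] [[x []]|] //= [xs].
    exists (Some (mkstate Xd' (eps_refl d'), true)); rewrite /= d'v; split=> //.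
    by split=> //; exists d; rewrite xs.
  + move=> [d [sd dv]] [[[[s' d'] /= [Xs sd']] []]|] //= [xs]; subst s'.
    by exists (Some (mkstate Xs sd, true)); rewrite /= dv.
Qed.

End LayerGame.

(** The strategy for the layer game is folded back onto [G] by merging Eve's commitment to [t] with
    Adam's answer. Commitment is silent, hence keeps [k], and since Adam owns [Ad t] all moves of
    [t] inside [X] are available. *)
Lemma layer_strategy (C : Type) (W : (nat -> C) -> Prop) (m : nat)
    (G S : graph (option C)) (pi : S -> G) (X : S -> Prop) :
  prefix_independent W -> eps_memory_le W m -> (exists w, W w) ->
  (forall p c, (forall n, X (p n)) -> (forall n, cstep (p n) (c n) (p n.+1)) -> W c) ->
  exists (P : G -> 'I_m -> Prop) (E : G -> 'I_m -> option C -> G -> 'I_m -> Prop),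
    [/\ forall s, X s -> exists k, P (pi s) k,
        forall v k, P v k -> exists t,
          [/\ X t, exists d, eps_reach t d /\ pi d = v,
              forall d, eps_reach t d -> P (pi d) k /\ E v k None (pi d) k &
              forall d c d', eps_reach t d -> edge d (Some c) d' -> X d' ->
                exists k', P (pi d') k' /\ E v k (Some c) (pi d') k'] &
        forall (q : nat -> G) (r : nat -> 'I_m) e,
          (forall n, P (q n) (r n) /\ E (q n) (r n) (e n) (q n.+1) (r n.+1)) ->
          Weps W e].
Proof.
move=> piW memW neW winX; have [X0|nX] := EM (exists s, X s); last first.
  exists (fun _ _ => False), (fun _ _ _ _ _ => False); split=> //.
  - by move=> s Xs; case: nX; exists s.
  - by move=> q r e /(_ 0)[].
have /eps_strategy_mem_strategy[//|P [E [[Edge Next Adam Win] [k0 Pk0]]]] :=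
  memW _ _ _ (layer_game_won pi X0 piW neW winX).
(* For a represented [v] the loop at [Ev v] is excluded, so Eve's move must be a commitment. *)
exists (fun v k => P (Ev v) k /\ exists s, represents pi X s v).
exists (fun v k a v' k' => exists t, E (Ev v) k None (Ad t) k /\ E (Ad t) k a (Ev v') k').
split.
- move=> s Xs.
  have rs : exists s', represents pi X s' (pi s).
    by exists s; split=> //; exists s; split=> //; apply: eps_refl.
  have [//|//|k Ek] := Adam Init k0 None (Ev (pi s)) Pk0.
  by exists k; split=> //; have [] := Edge _ _ _ _ _ Ek.
- move=> v k [Pv rv]; have [a [z [k' Ez]]] := Next _ _ Pv.
  have [Pz /= + +] := Edge _ _ _ _ _ Ez.
  case: a Ez => [//|] Ez; case: z Ez Pz => [//|v'|t] Ez Pz; first by case.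
  move=> [Xt [d [td dv]]] /(_ erefl) kk'; subst k'; exists t; split=> //.
  + by exists d.
  + move=> d1 td1; have [//||k' Ek'] := Adam (Ad t) k None (Ev (pi d1)) Pz.
      by exists d1.
    have [Pd1 _ /(_ erefl) kk'] := Edge _ _ _ _ _ Ek'; subst k'.
    by split; [split=> //; exists t; split=> //; exists d1 | exists t].
  + move=> d1 c d' td1 dc Xd'.
    have [//||k' Ek'] := Adam (Ad t) k (Some c) (Ev (pi d')) Pz; first by exists d1, d'.
    have [Pd' _ _] := Edge _ _ _ _ _ Ek'.
    exists k'; split; last by exists t.
    by split=> //; exists d'; split=> //; exists d'; split=> //; apply: eps_refl.
- move=> q r e qP; have [t tP] := choice (fun n => (qP n).2).
  apply: Weps_undouble => //.
  apply: (Win (fun n => if odd n then Ad (t n./2) else Ev (q n./2)) (fun n => r n./2)).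
    by have [[]] := qP 0.
  move=> n; rewrite /= uphalf_half; have [? ?] := tP n./2.
  by case: (odd n).
Qed.


(** * Combining the strategies of all layers *)

Lemma eps_reach_run (C : Type) (S : graph (option C)) (s d s' : S) (c : C) :
  eps_reach s d -> edge d (Some c) s' ->
  exists j, run edge s (rcons (nseq j None) (Some c)) s'.
Proof.
move=> sd dc.
have {dc} : run edge d [:: Some c] s' by exists s'.
(* Generalised over the number of epsilons, since the induction removes the last edge of the silent
   path. *)
rewrite -[[:: _]]/(rcons (nseq 0 None) _); move: 0.
elim: sd => [j rj|d1 d2 _ IH d12 j rj]; first by exists j.
by apply: (IH j.+1); exists d2.
Qed.

Lemma inf_noneps_of_size (C : Type) (e : nat -> option C) :
  (forall k, exists n, k < size (fproj e n)) -> inf_noneps e.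
Proof.
move=> unb N; apply: contrapT => noN.
have eN n : N <= n -> e n = None.
  by move=> Nn; apply: contrapT => en; apply: noN; exists n.
have szN n : size (fproj e n) <= size (fproj e N).
  have [nN|/ltnW Nn] := leqP n N.
    by have [u ->] := fproj_prefix e nN; rewrite size_cat leq_addr.
  rewrite -(subnKC Nn); elim: (n - N) => [|j IHj]; first by rewrite addn0.
  by rewrite addnS fprojSr eN ?leq_addr // cats0.
by have [n] := unb (size (fproj e N)); rewrite ltnNge szN.
Qed.

(** Expanding every [cstep] into its edges gives a path of [S] whose colours project to [c]. *)
Lemma winning_cstep (C : Type) (W : (nat -> C) -> Prop) (S : graph (option C))
    (s0 : S) (p : nat -> S) (c : nat -> C) :
  prefix_independent W -> winning s0 (Weps W) -> p 0 = s0 ->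
  (forall n, cstep (p n) (c n) (p n.+1)) -> W c.
Proof.
move=> piW win p0 sp.
have /choice[j jP] n : exists j, run edge (p n) (rcons (nseq j None) (Some (c n))) (p n.+1).
  by have [d [sd dc]] := sp n; apply: eps_reach_run dc.
pose w n := rcons (nseq (j n) None) (Some (c n)).
have [n|//|q [e [q0 qe ew]]] := @concat_runs _ _ edge p w; first by rewrite size_rcons.
have proj n : fproj e (size (flatten (mkseq w n))) = mkseq c n.
  rewrite /fproj ew; elim: n => // n IHn.
  rewrite !mkseqS flatten_rcons pmap_cat IHn -cats1 /w -cats1 pmap_cat.
  by congr (_ ++ _); elim: (j n).
have inf : inf_noneps e.
  apply: inf_noneps_of_size => k; exists (size (flatten (mkseq w k.+1))).
  by rewrite proj size_mkseq.
have /WepsE[//|[_ [v [pv Wv]]]|[]//] : Weps W e by apply: win qe; rewrite q0.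
suff <- : v = c by [].
apply/funext => k; have := pv (size (flatten (mkseq w k.+1))).
by rewrite proj size_mkseq => /(congr1 (nth (c k) ^~ k)); rewrite !nth_mkseq.
Qed.

Lemma infinite_path (A : Type) (S : graph A) (s : S) :
  exists p c, p 0 = s /\ forall n, edge (p n : S) (c n : A) (p n.+1).
Proof.
have [//||p [p0 _ pP]] := @dependent_choice_in S (fun=> True)
  (fun x y => exists a, edge x a y) s.
  by move=> x _; have [a [y xy]] := no_sink x; exists y; split=> //; exists a.
by have [c cP] := choice pP; exists p, c.
Qed.

Theorem theorem6p9 (C : Type) (m : nat) (W : nat -> (nat -> C) -> Prop) :
  (forall i, prefix_independent (W i)) ->
  (forall i, Sigma02 (W i)) ->
  (forall i, eps_memory_le (W i) m) ->
  eps_memory_le (fun w => exists i, W i w) m.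
Proof.
move=> piW sW memW G VE v0 [S [pi [s0 [[hom s0v adam] win]]]].
have piU : prefix_independent (fun w => exists i, W i w).
  by move=> u w; split=> -[i /(piW i u w)]; exists i.
have neW : exists i w, W i w.
  have [p [c [p0 pc]]] := infinite_path s0.
  by have [[_ [w [_ [i Ww]]]]|[N [_ [w [i Ww]]]]] := win p c p0 pc;
    exists i; eexists; apply: Ww.
(* Nothing is known about states that [s0] does not reach, so only good states are layered. *)
pose good s := forall p c, p 0 = s -> (forall n, @cstep C S (p n) (c n) (p n.+1)) ->
  exists i, W i c.
have goodS s c s' : good s -> cstep s c s' -> good s'.
  move=> gs sc p c' p0 sp.
  have [//|[|n] //=|i] :=
    gs (fun n => if n is k.+1 then p k else s) (prepend [:: c] c'); first by rewrite p0.
  by move=> /(piW i [:: c]); exists i.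
have good0 : good s0 by move=> p c; apply: (winning_cstep piU win).
have [I [lt [L [[wf tr] tot Lcov Ldown Lwin]]]] :=
  layering piW sW neW goodS (fun p c gp => gp p c erefl).
have /choice[PE PEP] : forall x, exists PE :
    (G -> 'I_m -> Prop) * (G -> 'I_m -> option C -> G -> 'I_m -> Prop), exists i,
    [/\ forall s, L x s -> exists k, PE.1 (pi s) k,
        forall v k, PE.1 v k -> exists t,
          [/\ L x t, exists d, eps_reach t d /\ pi d = v,
              forall d, eps_reach t d -> PE.1 (pi d) k /\ PE.2 v k None (pi d) k &
              forall d c d', eps_reach t d -> edge d (Some c) d' -> L x d' ->
                exists k', PE.1 (pi d') k' /\ PE.2 v k (Some c) (pi d') k'] &
        forall (q : nat -> G) (r : nat -> 'I_m) e,
          (forall n, PE.1 (q n) (r n) /\ PE.2 (q n) (r n) (e n) (q n.+1) (r n.+1)) ->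
          Weps (W i) e].
  move=> x; have [i [neWi winX]] := Lwin x.
  have [P [E PEP]] := layer_strategy pi (piW i) (memW i) neWi winX.
  by exists (P, E), i.
pose least x v k := (PE x).1 v k /\ forall y, (PE y).1 v k -> ~ lt y x.
have leastP x v k : (PE x).1 v k -> exists y, (y = x \/ lt y x) /\ least y v k.
  move=> Px; have [|y [Py yP]] := @wf_least _ lt (fun y => (PE y).1 v k) wf.
    by exists x.
  exists y; split=> //; have [|[|/yP]] := tot y x; by auto.
have least_uniq x y v k : least x v k -> least y v k -> x = y.
  move=> [Px xP] [Py yP]; have [|[//|]] := tot x y; first by move/yP.
  by move/xP.
pose Pset (z : (G * 'I_m)%type) := exists x, (PE x).1 z.1 z.2.
pose T := {z | Pset z}.
pose ES (z : T) (a : option C) (z' : T) :=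
  [/\ edge (sval z).1 a (sval z').1, a = None -> (sval z).2 = (sval z').2 &
    exists x y, [/\ least x (sval z).1 (sval z).2, least y (sval z').1 (sval z').2 &
      lt y x \/ (y = x /\ (PE x).2 (sval z).1 (sval z).2 a (sval z').1 (sval z').2)]].
(* Above each position lies a state [d] of [S] all of whose moves can be copied. This provides both
   a successor and an answer to each of Adam's moves. *)
have succ (z : T) : exists d, pi d = (sval z).1 /\
    forall a d', edge d a d' -> exists z', (sval z').1 = pi d' /\ ES z a z'.
  case: z => -[v k] /= [x0 Px0]; have [x [_ lx]] := leastP _ _ _ Px0.
  have [i [Pin Pt _]] := PEP x; have [t [Lt [d [td dv]] Teps Tc]] := Pt v k lx.1.
  exists d; split=> // a d' dd'; have := hom _ _ _ dd'; rewrite dv => vv'.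
  case: a dd' vv' => [c|] dd' vv'; last first.
    (* The state [d'] is still reached silently from the committed [t], so layer [x] contains its
       vertex with the same memory [k]. *)
    have [Pd' Ed'] := Teps d' (eps_step td dd').
    have [y [yx ly]] := leastP _ _ _ Pd'.
    exists (exist Pset (pi d', k) (ex_intro _ x Pd')); split=> //.
    by split=> //=; exists x, y; split=> //; case: yx => [->|]; auto.
  have [|y [[yx|yx] Ly]] := Ldown x t c d' Lt; first by exists d.
    rewrite yx in Ly; have [k' [Pd' Ed']] := Tc d c d' td dd' Ly.
    have [z [zx lz]] := leastP _ _ _ Pd'.
    exists (exist Pset (pi d', k') (ex_intro _ x Pd')); split=> //.
    by split=> //=; exists x, z; split=> //; case: zx => [->|]; auto.
  (* The layer drops; the move is coloured, so any memory [k'] that layer [y] offers may be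
     taken. *)
  have [iy [/(_ _ Ly)[k' Pd'] _ _]] := PEP y.
  have [z [zy lz]] := leastP _ _ _ Pd'.
  exists (exist Pset (pi d', k') (ex_intro _ y Pd')); split=> //.
  split=> //=; exists x, z; split=> //; left.
  by case: zy => [->//|zy]; apply: tr zy yx.
have nsink z : exists a z', ES z a z'.
  have [d [_ dP]] := succ z; have [a [d' dd']] := no_sink d.
  by have [z' [_ Ez]] := dP a d' dd'; exists a, z'.
have [x0 Lx0] := Lcov _ good0; have [i0 [/(_ _ Lx0)[k0 Pk0] _ _]] := PEP x0.
rewrite s0v in Pk0.
exists 'I_m, Pset, ES, nsink, (exist Pset (v0, k0) (ex_intro _ x0 Pk0)).
split=> //=; first by rewrite card_ord.
- split=> //= [z a z' [] //|v a v' nv vv' z zv].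
  have [d [dz dP]] := succ z; rewrite zv in dz.
  have [d' [d'v' dd']] := adam v a v' nv vv' d dz.
  by have [z' [z'd' Ez]] := dP a d' dd'; exists z'; rewrite z'd'.
- by move=> z z' [_ /(_ erefl)].
move=> p e _ pe.
have /choice[rk rkP] n : exists x, least x (sval (p n)).1 (sval (p n)).2.
  by have [_ _ [x [y [lx _ _]]]] := pe n; exists x.
(* From a time [N] of minimal rank on, only the second alternative of [pe'] is possible, and the
   suffix is a play of one layer strategy. *)
have [|_ [[N ->] NP]] := @wf_least _ lt (fun x => exists n, x = rk n) wf.
  by exists (rk 0), 0.
have pe' n : lt (rk n.+1) (rk n) \/ (rk n.+1 = rk n /\
    (PE (rk n)).2 (sval (p n)).1 (sval (p n)).2 (e n) (sval (p n.+1)).1 (sval (p n.+1)).2).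
  have [_ _ [x [y [lx ly H]]]] := pe n.
  by rewrite (least_uniq _ _ _ _ (rkP n) lx) (least_uniq _ _ _ _ (rkP n.+1) ly).
have rkN n : rk (N + n) = rk N.
  elim: n => [|n IHn]; first by rewrite addn0.
  by rewrite addnS -IHn; case: (pe' (N + n)) => [|[]] //; rewrite IHn => /NP[]; eexists.
have [i [_ _ Wi]] := PEP (rk N).
have /Weps_shift : Weps (W i) (fun n => e (N + n)).
  apply: (Wi (fun n => (sval (p (N + n))).1) (fun n => (sval (p (N + n))).2)) => n.
  have [Pn _] := rkP (N + n); rewrite rkN in Pn; split=> //.
  by case: (pe' (N + n)) => [|[_]]; rewrite -?addnS !rkN // => /NP[]; exists N.
move=> /(_ (piW i)); case=> [[inf [v [pv Wv]]]|[K [eK [w Ww]]]].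
  by left; split=> //; exists v; split=> //; exists i.
by right; exists K; split=> //; exists w, i.
Qed.
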